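(* Let $d\ge2$ and let $T',T''\in\mathbb{R}^{n_1\times\cdots\times n_d}$ be tensors with TR-representations given by cores $G_k'$ and $G_k''$, $k=1,\ldots,d$, respectively. Define the tensor $T$ by its TR-cores $$G_k(i_k)=\begin{bmatrix}G_k'(i_k)&0\\0&G_k''(i_k)\end{bmatrix},\qquad k=1,\ldots,d$$ (including $k=1$ and $k=d$). If the TR-ranks of the given representations of $T'$ and $T''$ are minimal, then calling the TR-rounding algorithm on $T$ (given by the cores $G_k$) with accuracy $\varepsilon=0$ returns cores with the same size as the input cores $G_k$.
   Context: TR-format: a TR-representation of $T\in\mathbb{R}^{n_1\times\cdots\times n_d}$ with TR-rank $(r_0,r_1,\ldots,r_{d-1},r_d)$, $r_d=r_0$ (positive integers), consists of cores $G_k\in\mathbb{R}^{r_{k-1}\times n_k\times r_k}$, with matrix slices $G_k(i_k)\in\mathbb{R}^{r_{k-1}\times r_k}$, such that $T(i_1,\ldots,i_d)=\operatorname{Trace}(G_1(i_1)\cdots G_d(i_d))$ for all indices. Minimal rank: a vector $r=(r_0,\ldots,r_{d-1},r_0)$ is a minimal rank of a tensor if (i) there is a TR-representation of the tensor with TR-rank $r$, and (ii) no other vector $r'\ne r$ that is the TR-rank of a TR-representation of the tensor satisfies $r'\le r$ elementwise. Conventions: the $k$-mode product of a tensor $X$ with a matrix $A$ is $(X\times_kA)(i_1,\ldots,i_{k-1},j,i_{k+1},\ldots)=\sum_{i_k}X(i_1,i_2,\ldots)A(j,i_k)$. For a matrix $A$, $\mathrm{SVD}_\delta(A)$ denotes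 a $\delta$-truncated SVD: matrices $U,\Sigma,V$, with $U,V$ having orthonormal columns and $\Sigma$ square diagonal with positive diagonal entries, obtained by truncating an SVD of $A$ to the smallest rank for which $\|A-U\Sigma V^T\|_F\le\delta$ (for $\delta=0$: a compact SVD). QR denotes a reduced QR-decomposition: for a $p\times q$ matrix, the factor $Q$ has $\min(p,q)$ orthonormal columns. Reshapes use MATLAB (column-major) ordering. TR-rounding algorithm (input: cores $G_1,\ldots,G_d$ of $T$, with sizes $r_{k-1}\times n_k\times r_k$, and accuracy $\varepsilon$). Put $\delta=\varepsilon\|T\|_F/\sqrt{d\,r_0}$. (1) QR-sweep: for $k=1,\ldots,d-1$, compute the QR-decomposition $Q_kR_k$ of $G_k$ reshaped to size $r_{k-1}n_k\times r_k$; replace $r_k$ by the number of columns of $Q_k$, $G_k$ by $Q_k$ reshaped to size $r_{k-1}\times n_k\times r_k$, and $G_{k+1}$ by $G_{k+1}\times_1R_k$. (2) Cyclic step: compute the QR-decomposition $Q_dR_d$ of $G_d$ reshaped to size $r_{d-1}n_d\times r_d$, and $[U_d,\Sigma_d,V_d]=\mathrm{SVD}_\delta(R_d)$; let $\widetilde r_d=\operatorname{rank}(\Sigma_d)$. If $\widetilde r_d<r_d$, replace $G_d$ by $Q_dU_d\Sigma_d$ reshaped to size $r_{d-1}\times n_d\times\widetilde r_d$ and $G_1$ by $G_1\times_1V_d^T$; otherwise leave $G_d$ and $G_1$ unchanged. (3) SVD-sweep: for $k=d,d-1,\ldots,2$, compute $[U_k,\Sigma_k,V_k]=\mathrm{SVD}_\delta$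 of $G_k$ reshaped to size $r_{k-1}\times n_k\widetilde r_k$; let $\widetilde r_{k-1}=\operatorname{rank}(\Sigma_k)$, let $\widetilde G_k$ be $V_k^T$ reshaped to size $\widetilde r_{k-1}\times n_k\times\widetilde r_k$, and replace $G_{k-1}$ by $G_{k-1}\times_3(U_k\Sigma_k)^T$. (4) Set $\widetilde G_1=G_1$ and return $\widetilde G_1,\ldots,\widetilde G_d$.
   Formalization: The formal theorem additionally assumes that T' and T'' are both nonzero; for a zero tensor the minimal TR-rank is (1,…,1) with some zero core, and TR-rounding with ε=0 then shrinks the cores, so the claim fails. *)

(* Defs.v *)
From HB Require Import structures.
From mathcomp Require Import all_boot all_order all_algebra.
From mathcomp Require Import reals.

Set Implicit Arguments.
Unset Strict Implicit.
Unset Printing Implicit Defensive.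

Import Order.TTheory GRing.Theory Num.Theory.
Local Open Scope ring_scope.

(** * Tensors and TR-representations

  Modes are numbered from 0: the mode k : 'I_d is the mode k + 1 of the usual
  notation, so that the core at k has size r_k * n_(k+1) * r_(k+1).  A rank
  vector (r_0, ..., r_d) is a function r : nat -> nat of which only the values
  at 0, ..., d are meaningful. *)

Definition tensor (R : Type) (d : nat) (n : 'I_d -> nat) : Type :=
  {dffun forall k : 'I_d, 'I_(n k)} -> R.

Definition tensor_norm (R : rcfType) (d : nat) (n : 'I_d -> nat)
    (T : tensor R n) : R :=
  Num.sqrt (\sum_i T i ^+ 2).

Definition tr_cores (R : Type) (d : nat) (n : 'I_d -> nat) (r : nat -> nat) :
    Type :=
  forall k : 'I_d, 'I_(n k) -> 'M[R]_(r k, r k.+1).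

(* The product of the first k slices G_1(i_1) ... G_k(i_k). *)
Fixpoint slice_prod (R : pzRingType) (d : nat) (n : 'I_d -> nat)
    (r : nat -> nat) (G : tr_cores R n r) (i : forall k : 'I_d, 'I_(n k))
    (k : nat) : (k <= d)%N -> 'M[R]_(r 0, r k) :=
  match k return (k <= d)%N -> 'M[R]_(r 0, r k) with
  | 0 => fun _ => 1%:M
  | k'.+1 => fun lt_k'd =>
      slice_prod G i (ltnW lt_k'd)
        *m G (Ordinal lt_k'd) (i (Ordinal lt_k'd))
  end.

Definition tr_representation (R : pzRingType) (d : nat) (n : 'I_d -> nat)
    (T : tensor R n) (r : nat -> nat) (G : tr_cores R n r) : Prop :=
  (forall k, (k <= d)%N -> (0 < r k)%N) /\
  exists rd : r d = r 0,
    forall i, T i = \tr (castmx (erefl (r 0), rd) (slice_prod G i (leqnn d))).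

Definition tr_rank (R : pzRingType) (d : nat) (n : 'I_d -> nat)
    (T : tensor R n) (r : nat -> nat) : Prop :=
  exists G : tr_cores R n r, tr_representation T G.

Definition minimal_rank (R : pzRingType) (d : nat) (n : 'I_d -> nat)
    (T : tensor R n) (r : nat -> nat) : Prop :=
  tr_rank T r /\
  forall r' : nat -> nat, tr_rank T r' ->
    (forall k, (k <= d)%N -> (r' k <= r k)%N) ->
    forall k, (k <= d)%N -> r' k = r k.

Definition block_cores (R : pzRingType) (d : nat) (n : 'I_d -> nat)
    (r' r'' : nat -> nat) (G' : tr_cores R n r') (G'' : tr_cores R n r'') :
    tr_cores R n (fun k => r' k + r'' k)%N :=
  fun k i => block_mx (G' k i) 0 0 (G'' k i).

(** * Matrix decompositions *)

Definition frob_norm (R : rcfType) (p q : nat) (A : 'M[R]_(p, q)) : R :=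
  Num.sqrt (\sum_i \sum_j A i j ^+ 2).

(* [is_trig_mx] means lower triangular, hence the transpose. *)
Definition is_qr (R : rcfType) (p q : nat) (A : 'M[R]_(p, q))
    (Q : 'M[R]_(p, minn p q)) (S : 'M[R]_(minn p q, q)) : Prop :=
  [/\ Q^T *m Q = 1%:M, is_trig_mx S^T & A = Q *m S].

Definition is_compact_svd (R : rcfType) (p q s : nat) (A : 'M[R]_(p, q))
    (U : 'M[R]_(p, s)) (sigma : 'rV[R]_s) (V : 'M[R]_(q, s)) : Prop :=
  [/\ U^T *m U = 1%:M, V^T *m V = 1%:M, forall i, 0 < sigma 0 i,
      forall i j : 'I_s, (i <= j)%N -> sigma 0 j <= sigma 0 i
    & A = U *m diag_mx sigma *m V^T].

Definition first_cols (R : Type) (p s t : nat) (le_ts : (t <= s)%N)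
    (M : 'M[R]_(p, s)) : 'M[R]_(p, t) :=
  colsub (widen_ord le_ts) M.

Definition svd_truncation (R : rcfType) (p q s t : nat) (le_ts : (t <= s)%N)
    (U : 'M[R]_(p, s)) (sigma : 'rV[R]_s) (V : 'M[R]_(q, s)) : 'M[R]_(p, q) :=
  first_cols le_ts U *m diag_mx (first_cols le_ts sigma)
    *m (first_cols le_ts V)^T.

(* [U, Sigma, V] = SVD_delta(A): since only positive singular values are kept,
   truncating a full SVD and truncating a compact one are the same thing. *)
Definition is_truncated_svd (R : rcfType) (delta : R) (p q t : nat)
    (A : 'M[R]_(p, q))
    (U : 'M[R]_(p, t)) (Sigma : 'M[R]_t) (V : 'M[R]_(q, t)) : Prop :=
  exists (s : nat) (U0 : 'M[R]_(p, s)) (sigma0 : 'rV[R]_s) (V0 : 'M[R]_(q, s)),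
    is_compact_svd A U0 sigma0 V0 /\
    exists le_ts : (t <= s)%N,
      [/\ U = first_cols le_ts U0,
          Sigma = diag_mx (first_cols le_ts sigma0),
          V = first_cols le_ts V0,
          frob_norm (A - U *m Sigma *m V^T) <= delta
        & forall (t' : nat) (le_t's : (t' <= s)%N),
            frob_norm (A - svd_truncation le_t's U0 sigma0 V0) <= delta ->
            (t <= t')%N].

(* Hence the number of columns of U and V is the rank of Sigma. *)
Lemma rank_truncated_svd (R : rcfType) (delta : R) (p q t : nat)
    (A : 'M[R]_(p, q)) (U : 'M[R]_(p, t)) (Sigma : 'M[R]_t)
    (V : 'M[R]_(q, t)) :
  is_truncated_svd delta A U Sigma V -> \rank Sigma = t.
Proof.
move=> [s [U0 [sigma0 [V0 [[_ _ sigma_gt0 _ _] [le_ts [_ -> _ _ _]]]]]]].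
apply: mxrank_unit; rewrite unitmxE det_diag unitfE.
by apply/prodf_neq0 => i _; rewrite mxE gt_eqF.
Qed.

(** * Cores of varying size, reshapes and mode products *)

Record core (R : Type) (n : nat) : Type := Core {
  lsize : nat;
  rsize : nat;
  slice : 'I_n -> 'M[R]_(lsize, rsize) }.

Fact colmajor_fst_subproof (a b : nat) (p : 'I_(a * b)) : (p %% a < a)%N.
Proof. by rewrite ltn_mod; case: a p => // -[]. Qed.

Fact colmajor_snd_subproof (a b : nat) (p : 'I_(a * b)) : (p %/ a < b)%N.
Proof. by rewrite ltn_divLR ?(mulnC b) //; case: a p => // -[]. Qed.

Fact colmajor_subproof (a b : nat) (i : 'I_a) (j : 'I_b) :
  (i + a * j < a * b)%N.
Proof.
apply: (@leq_trans (a * j.+1)); last by rewrite leq_mul2l ltn_ord orbT.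
by rewrite mulnS ltn_add2r.
Qed.

(* Column-major linear indexing of pairs: (i, j) has position i + a * j. *)
Definition colmajor (a b : nat) (i : 'I_a) (j : 'I_b) : 'I_(a * b) :=
  Ordinal (colmajor_subproof i j).
Definition colmajor_fst (a b : nat) (p : 'I_(a * b)) : 'I_a :=
  Ordinal (colmajor_fst_subproof p).
Definition colmajor_snd (a b : nat) (p : 'I_(a * b)) : 'I_b :=
  Ordinal (colmajor_snd_subproof p).

(* Reshapes of an l * n * r core to size (l n) * r and l * (n r), and back. *)
Definition left_unfold (R : Type) (n : nat) (X : core R n) :
    'M[R]_(lsize X * n, rsize X) :=
  \matrix_(p, c) slice X (colmajor_snd p) (colmajor_fst p) c.

Definition right_unfold (R : Type) (n : nat) (X : core R n) :
    'M[R]_(lsize X, n * rsize X) :=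
  \matrix_(a, p) slice X (colmajor_fst p) a (colmajor_snd p).

Definition left_fold (R : Type) (l n r : nat) (A : 'M[R]_(l * n, r)) :
    core R n :=
  Core (fun i => \matrix_(a < l, c < r) A (colmajor a i) c).

Definition right_fold (R : Type) (l n r : nat) (A : 'M[R]_(l, n * r)) :
    core R n :=
  Core (fun i => \matrix_(a < l, c < r) A a (colmajor i c)).

(* The mode products X x_1 A and X x_3 A.  The sizes match, i.e. q = lsize X
   (resp. q = rsize X), whenever these are used in the algorithm below, and
   then [conform_mx] only serves as a cast. *)
Definition mode1_prod (R : pzRingType) (n p q : nat) (X : core R n)
    (A : 'M[R]_(p, q)) : core R n :=
  Core (fun i => A *m conform_mx (0 : 'M[R]_(q, rsize X)) (slice X i)).

Definition mode3_prod (R : pzRingType) (n p q : nat) (X : core R n)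
    (A : 'M[R]_(p, q)) : core R n :=
  Core (fun i => conform_mx (0 : 'M[R]_(lsize X, q)) (slice X i) *m A^T).

(** * TR-rounding

  QR-decompositions and SVDs are not unique, so each step is a relation
  between the states (families of cores) before and after it; the "replace"
  instructions are [dfwith] updates. *)

Definition state (R : Type) (d : nat) (n : 'I_d -> nat) : Type :=
  forall k : 'I_d, core R (n k).

Definition state_of_cores (R : Type) (d : nat) (n : 'I_d -> nat)
    (r : nat -> nat) (G : tr_cores R n r) : state R n :=
  fun k => Core (G k).

(* Used for k.+1 < d only, where ordS k is k + 1. *)
Definition qr_step (R : rcfType) (d : nat) (n : 'I_d -> nat) (k : 'I_d)
    (G H : state R n) : Prop :=
  exists Q S, is_qr (left_unfold (G k)) Q S /\
    H = dfwith (dfwith G (i := k) (left_fold Q))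
               (i := ordS k) (mode1_prod (G (ordS k)) S).

(* Used for the last k only, where ordS k is 0. *)
Definition cyclic_step (R : rcfType) (d : nat) (n : 'I_d -> nat) (delta : R)
    (k : 'I_d) (G H : state R n) : Prop :=
  exists Q S, is_qr (left_unfold (G k)) Q S /\
  exists t (U : 'M_(_, t)) (Sigma : 'M_t) (V : 'M_(_, t)),
    is_truncated_svd delta S U Sigma V /\
    H = if (\rank Sigma < rsize (G k))%N
        then dfwith (dfwith G (i := k) (left_fold (Q *m U *m Sigma)))
                    (i := ordS k) (mode1_prod (G (ordS k)) V^T)
        else G.

(* Used for 0 < k only, where ord_pred k is k - 1. *)
Definition svd_step (R : rcfType) (d : nat) (n : 'I_d -> nat) (delta : R)
    (k : 'I_d) (G H : state R n) : Prop :=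
  exists t (U : 'M_(_, t)) (Sigma : 'M_t) (V : 'M_(_, t)),
    is_truncated_svd delta (right_unfold (G k)) U Sigma V /\
    H = dfwith (dfwith G (i := k) (right_fold V^T))
               (i := ord_pred k)
               (mode3_prod (G (ord_pred k)) (U *m Sigma)^T).

(* Performs [step k] for the successive members k of ks. *)
Fixpoint sweep (R : Type) (d : nat) (n : 'I_d -> nat)
    (step : 'I_d -> state R n -> state R n -> Prop) (ks : seq 'I_d)
    (G H : state R n) : Prop :=
  if ks is k :: ks' then exists2 G1, step k G G1 & sweep step ks' G1 H
  else H = G.

(* [tr_rounding T G eps H]: the algorithm, called on the cores G of T with
   accuracy eps, can return the cores H. *)
Definition tr_rounding (R : rcfType) (d : nat) (n : 'I_d -> nat)
    (T : tensor R n) (r : nat -> nat) (G : tr_cores R n r) (eps : R)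
    (H : state R n) : Prop :=
  let delta := eps * tensor_norm T / Num.sqrt (d * r 0)%:R in
  exists (G1 G2 : state R n) (last : 'I_d),
    [/\ sweep (@qr_step R d n) [seq k : 'I_d <- enum 'I_d | (k.+1 < d)%N]
          (state_of_cores G) G1,
        last.+1 = d,
        cyclic_step delta last G1 G2
      & sweep (@svd_step R d n delta)
          (rev [seq k : 'I_d <- enum 'I_d | (0 < k)%N]) G2 H].

(* Main.v *)
Require Import Defs.
From mathcomp Require Import all_boot all_order all_algebra.
From mathcomp Require Import reals.
Import Order.TTheory GRing.Theory Num.Theory.
Local Open Scope ring_scope.

(** Call a core nondegenerate when its left unfolding has full column rank and
  its right unfolding has full row rank.

  A minimal representation of a nonzero tensor has only nondegenerate cores
  ([minimal_nondegenerate]).  Indeed, let L be the left unfolding of the core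
  at k.  The projector E onto the row space of L satisfies G_k(i) E = G_k(i)
  for all i, so that E can be inserted at the bond between k and k + 1 without
  changing the tensor; splitting E through its image lowers the size of that
  bond to the rank of L.  By minimality that rank is already the size of the
  bond.  Right unfoldings are treated in the same way, with a projector that
  absorbs G_k(i) from the left.  The last bond closes the ring: its size is
  counted both as r_0 and as r_d, and there the cyclicity of the trace makes
  the insertion harmless.  That the tensor is nonzero ensures that the reduced
  bond sizes remain positive, as a rank vector must be.

  The unfoldings of a block-diagonal core are, up to a permutation of rows or
  columns, the direct sums of those of its blocks, so the cores of T are
  nondegenerate ([block_cores_nondegenerate]).

  Finally, exact rounding cannot shrink such cores.  A QR-decomposition or an
  SVD with zero error is an exact factorization of an unfolding of full rank
  whose inner dimension does not exceed that rank.  The inner dimension then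
  equals the rank, the factor pushed to the neighbouring core is invertible,
  and both modified cores are nondegenerate again with their old sizes
  ([left_factor_nondegenerate], [right_factor_nondegenerate]).  So the sizes
  and nondegeneracy are invariants of both sweeps, and the cyclic step, whose
  truncation is performed only if the rank drops, does nothing. *)

Set Implicit Arguments.
Unset Strict Implicit.
Unset Printing Implicit Defensive.

(** * Full rank matrices *)

Lemma row_full_kerP (F : fieldType) (p q : nat) (A : 'M[F]_(p, q)) :
  (forall m (v : 'M_(q, m)), A *m v = 0 -> v = 0) <-> row_full A.
Proof.
split=> [A_inj | A_full m v Av0].
  by rewrite -cokermx_eq0; apply/eqP/A_inj/mulmx_coker.
by apply: (row_full_inj A_full); rewrite Av0 mulmx0.
Qed.

Lemma row_free_kerP (F : fieldType) (p q : nat) (A : 'M[F]_(p, q)) :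
  (forall m (u : 'M_(m, p)), u *m A = 0 -> u = 0) <-> row_free A.
Proof.
split=> [A_inj | A_free m u uA0].
  by rewrite -kermx_eq0; apply/eqP/A_inj/mulmx_ker.
by apply: (row_free_inj A_free); rewrite uA0 mul0mx.
Qed.

(** An inner dimension at most q is squeezed between the rank q of the product
  and q itself. *)
Lemma row_full_factor (F : fieldType) (p m q : nat) (B : 'M[F]_(p, m))
    (C : 'M_(m, q)) :
  row_full (B *m C) -> (m <= q)%N ->
  [/\ m = q, row_full B, row_full C & row_free C].
Proof.
move=> BC_full le_mq.
have le_qC : (q <= \rank C)%N by rewrite -{1}(eqP BC_full) mxrankM_maxr.
have Eqm : m = q.
  by apply/eqP; rewrite eqn_leq le_mq (leq_trans le_qC) ?rank_leq_row.
split=> //; last by rewrite /row_free eqn_leq rank_leq_row (leq_trans le_mq).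
  rewrite /row_full eqn_leq rank_leq_col (leq_trans le_mq) // -(eqP BC_full).
  exact: mxrankM_maxl.
by rewrite /row_full eqn_leq rank_leq_col.
Qed.

Lemma row_free_factor (F : fieldType) (p m q : nat) (B : 'M[F]_(p, m))
    (C : 'M_(m, q)) :
  row_free (B *m C) -> (m <= p)%N ->
  [/\ m = p, row_full B, row_free B & row_free C].
Proof.
move=> BC_free le_mp.
have le_pm : (p <= \rank B)%N by rewrite -{1}(eqP BC_free) mxrankM_maxl.
have Epm : m = p.
  by apply/eqP; rewrite eqn_leq le_mp (leq_trans le_pm) ?rank_leq_col.
split=> //.
  by rewrite /row_full eqn_leq rank_leq_col (leq_trans le_mp le_pm).
  by rewrite /row_free eqn_leq rank_leq_row le_pm.
rewrite /row_free eqn_leq rank_leq_row /= {1}Epm -{1}(eqP BC_free).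
exact: mxrankM_maxr.
Qed.

Lemma castmx_mulmx (F : fieldType) (a a' b b' c c' : nat) (ea : a = a')
    (eb : b = b') (ec : c = c') (X : 'M[F]_(a, b)) (Y : 'M_(b, c)) :
  castmx (ea, ec) (X *m Y) = castmx (ea, eb) X *m castmx (eb, ec) Y.
Proof. by case: _ / ea; case: _ / eb; case: _ / ec. Qed.

(** The column and row bases of an idempotent split it through its image. *)
Lemma idempotent_base (F : fieldType) (p : nat) (E : 'M[F]_p) :
  E *m E = E -> row_base E *m col_base E = 1%:M.
Proof.
move=> EE; move: (mulmx_base E) (col_base_full E) (row_base_free E).
move: (col_base E) (row_base E) => C B CB C_full B_free.
apply: (row_free_inj B_free); apply: (row_full_inj C_full).
by rewrite mul1mx !mulmxA CB -mulmxA CB.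
Qed.

(** Since the bases of a matrix depend on its dimensions, this transport is what
  identifies the two copies of the bond that closes the ring. *)
Lemma base_castmx (F : fieldType) (a b : nat) (e : a = b)
    (A : 'M[F]_a) (B : 'M_b) : castmx (e, e) A = B ->
  exists e' : \rank A = \rank B,
    castmx (e, e') (col_base A) = col_base B /\
    castmx (e', e) (row_base A) = row_base B.
Proof. by case: _ / e B => B /= <-; exists erefl. Qed.

(** * Compressing the bonds of a representation *)

Section Compression.
Variables (F : fieldType) (d : nat) (n : 'I_d -> nat) (r : nat -> nat).
Variables (G : tr_cores F n r).
Arguments G : clear implicits.

Lemma slice_prod_eq0 (i : forall k, 'I_(n k)) (k : 'I_d) : G k (i k) = 0 ->
  forall m (le_md : (m <= d)%N), (k < m)%N -> slice_prod G i le_md = 0.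
Proof.
move=> Gk0; elim=> // m IH lt_md /=; rewrite ltnS leq_eqVlt => /predU1P[km|km].
  have Ek : k = Ordinal lt_md by apply: val_inj.
  by rewrite Ek in Gk0; rewrite Gk0 mulmx0.
by rewrite IH // mul0mx.
Qed.

Lemma tr_slice_neq0 (T : tensor F n) i (k : 'I_d) :
  tr_representation T G -> T i != 0 -> G k (i k) != 0.
Proof.
move=> [_ [rd ->]]; apply: contra_neq => /slice_prod_eq0 Gk0.
rewrite Gk0 ?ltn_ord //.
by case: _ / rd; rewrite /= mxtrace0.
Qed.

Variables (s : nat -> nat).
Variables (C : forall m, 'M[F]_(r m, s m)) (B : forall m, 'M[F]_(s m, r m)).
Hypothesis BC : forall m, B m *m C m = 1%:M.
Hypothesis absorbed :
  (forall k i, G k i *m (C k.+1 *m B k.+1) = G k i) \/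
  (forall (k : 'I_d) i, C k *m B k *m G k i = G k i).

(** The products C m *m B m are projectors that the cores absorb on one fixed
  side; inserting them at every bond leaves the products of slices intact. *)
Definition compressed_cores : tr_cores F n s :=
  fun k i => B k *m G k i *m C k.+1.

Lemma slice_prod_compressed i m (le_md : (m <= d)%N) :
  slice_prod compressed_cores i le_md = B 0 *m slice_prod G i le_md *m C m.
Proof.
elim: m le_md => [|m IH] lt_md /=; first by rewrite mulmx1 BC.
rewrite IH /compressed_cores !mulmxA; congr (_ *m _).
case: absorbed => EG;
  last by rewrite -!mulmxA (mulmxA (C m)) (EG (Ordinal lt_md)).
(* Here the slices absorb the projectors on their right, so that the projector at bond 0, which
   has no slice on its left, must be absorbed by B 0 instead. *)
congr (_ *m _); case: m {IH} lt_md => [|m] lt_md /=.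
  by rewrite mulmx1 BC mul1mx.
by rewrite -!mulmxA (EG (Ordinal (ltnW lt_md))).
Qed.

Lemma slice_prod_absorbed i m (le_md : (m <= d)%N) : (0 < m)%N ->
  slice_prod G i le_md *m (C m *m B m) = slice_prod G i le_md \/
  C 0 *m B 0 *m slice_prod G i le_md = slice_prod G i le_md.
Proof.
move=> m_gt0; case: absorbed => EG.
  left; case: m le_md m_gt0 => //= m lt_md _.
  by rewrite -mulmxA (EG (Ordinal lt_md)).
right; elim: m le_md m_gt0 => //= -[|m] IH lt_md _.
  by rewrite /= mul1mx (EG (Ordinal lt_md)).
by rewrite mulmxA IH.
Qed.

Hypothesis d_gt0 : (0 < d)%N.
Variables (rd : r d = r 0) (sd : s d = s 0).
Hypothesis Cd : castmx (rd, sd) (C d) = C 0.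
Hypothesis Bd : castmx (sd, rd) (B d) = B 0.

(** The factors B 0 and C d left over at the two ends of the compressed product
  meet under the trace, because of its cyclicity, and form the projector of
  the closing bond, which the uncompressed product absorbs.  A bond of size 0
  would make its projector, hence all the slices of the core that absorbs it,
  vanish. *)
Lemma tr_rank_compress (T : tensor F n) :
  tr_representation T G -> (exists i, T i != 0) -> tr_rank T s.
Proof.
move=> TG [i0 Ti0]; exists compressed_cores.
have CB_neq0 m : C m *m B m != 0 -> (0 < s m)%N.
  move: (s m) (C m) (B m) => [|//] C0 B0.
  by rewrite [C0]thinmx0 mul0mx eqxx.
split=> [m le_md|].
  have Gn0 k := tr_slice_neq0 k TG Ti0.
  case: absorbed => EG.
    have s_gt0 (k : 'I_d) : (0 < s k.+1)%N.
      apply: CB_neq0; apply: contraNneq (Gn0 k) => E0.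
      by rewrite -EG E0 mulmx0.
    case: m le_md => [_ | m lt_md]; last exact: (s_gt0 (Ordinal lt_md)).
    have lt_d : (d.-1 < d)%N by rewrite prednK.
    by rewrite -sd -(prednK d_gt0) (s_gt0 (Ordinal lt_d)).
  have s_gt0 (k : 'I_d) : (0 < s k)%N.
    apply: CB_neq0; apply: contraNneq (Gn0 k) => E0.
    by rewrite -EG E0 mul0mx.
  move: le_md; rewrite leq_eqVlt => /predU1P[-> | lt_md].
    by rewrite sd (s_gt0 (Ordinal d_gt0)).
  exact: (s_gt0 (Ordinal lt_md)).
exists sd => i; rewrite slice_prod_compressed -mulmxA.
rewrite (castmx_mulmx erefl erefl sd) castmx_id (castmx_mulmx erefl rd sd) Cd.
rewrite mxtrace_mulC -mulmxA mxtrace_mulC.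
case: TG => _ [rd' ->]; rewrite (eq_irrelevance rd' rd).
have [PE | EP] := slice_prod_absorbed i (leqnn d) d_gt0.
  rewrite -{1}PE (castmx_mulmx erefl rd rd) (castmx_mulmx rd sd rd) Cd Bd.
  exact: mxtrace_mulC.
by rewrite -{1}EP (castmx_mulmx erefl erefl rd) castmx_id.
Qed.

End Compression.

(** * Unfoldings of cores *)

Section Unfoldings.
Variables (F : fieldType) (n : nat).
Implicit Types X : core F n.

Lemma colmajorK_fst (a b : nat) (i : 'I_a) (j : 'I_b) :
  colmajor_fst (colmajor i j) = i.
Proof. by apply: val_inj; rewrite /= addnC mulnC modnMDl modn_small. Qed.

Lemma colmajorK_snd (a b : nat) (i : 'I_a) (j : 'I_b) :
  colmajor_snd (colmajor i j) = j.
Proof.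
have a_gt0 : (0 < a)%N by case: (a) i => // -[].
by apply: val_inj; rewrite /= addnC mulnC divnMDl // divn_small ?addn0.
Qed.

Lemma colmajorK (a b : nat) (p : 'I_(a * b)) :
  colmajor (colmajor_fst p) (colmajor_snd p) = p.
Proof. by apply: val_inj; rewrite /= addnC mulnC -divn_eq. Qed.

Lemma left_unfold_mul_eq0 X m (v : 'M_(rsize X, m)) :
  left_unfold X *m v = 0 <-> forall i, slice X i *m v = 0.
Proof.
have unfoldE p c : (left_unfold X *m v) p c
    = (slice X (colmajor_snd p) *m v) (colmajor_fst p) c.
  by rewrite !mxE; apply: eq_bigr => j _; rewrite !mxE.
split=> [Xv0 i | Xv0]; apply/matrixP => a c.
  by rewrite -(colmajorK_fst a i) -{1}(colmajorK_snd a i) -unfoldE Xv0 !mxE.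
by rewrite unfoldE Xv0 !mxE.
Qed.

Lemma mul_right_unfold_eq0 X m (u : 'M_(m, lsize X)) :
  u *m right_unfold X = 0 <-> forall i, u *m slice X i = 0.
Proof.
have unfoldE a p : (u *m right_unfold X) a p
    = (u *m slice X (colmajor_fst p)) a (colmajor_snd p).
  by rewrite !mxE; apply: eq_bigr => j _; rewrite !mxE.
split=> [uX0 i | uX0]; apply/matrixP => a c.
  by rewrite -(colmajorK_snd i c) -{1}(colmajorK_fst i c) -unfoldE uX0 !mxE.
by rewrite unfoldE uX0 !mxE.
Qed.

Definition nondegenerate X : bool :=
  row_full (left_unfold X) && row_free (right_unfold X).

Lemma row_full_left_unfoldP X :
  (forall m (v : 'M_(rsize X, m)), (forall i, slice X i *m v = 0) -> v = 0)
  <-> row_full (left_unfold X).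
Proof.
rewrite -row_full_kerP; split=> X_inj m v; last first.
  by move/left_unfold_mul_eq0; apply: X_inj.
by move=> Xv0; apply: X_inj; apply/left_unfold_mul_eq0.
Qed.

Lemma row_free_right_unfoldP X :
  (forall m (u : 'M_(m, lsize X)), (forall i, u *m slice X i = 0) -> u = 0)
  <-> row_free (right_unfold X).
Proof.
rewrite -row_free_kerP; split=> X_inj m u; last first.
  by move/mul_right_unfold_eq0; apply: X_inj.
by move=> uX0; apply: X_inj; apply/mul_right_unfold_eq0.
Qed.

Lemma nondegenerateP X :
  (forall m (v : 'M_(rsize X, m)), (forall i, slice X i *m v = 0) -> v = 0) ->
  (forall m (u : 'M_(m, lsize X)), (forall i, u *m slice X i = 0) -> u = 0) ->
  nondegenerate X.
Proof.
by move=> /row_full_left_unfoldP Xl /row_free_right_unfoldP Xr; apply/andP.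
Qed.

Lemma nondegenerate_eq0 X : nondegenerate X ->
  (forall m (v : 'M_(rsize X, m)), (forall i, slice X i *m v = 0) -> v = 0) /\
  (forall m (u : 'M_(m, lsize X)), (forall i, u *m slice X i = 0) -> u = 0).
Proof.
by case/andP=> /row_full_left_unfoldP Xl /row_free_right_unfoldP Xr.
Qed.

Lemma slice_mul_row_projector X i :
  slice X i *m (pinvmx (left_unfold X) *m left_unfold X) = slice X i.
Proof.
apply/eqP; rewrite -subr_eq0 -{2}[slice X i]mulmx1 -mulmxBr; apply/eqP.
move: i; apply/left_unfold_mul_eq0.
by rewrite mulmxBr mulmx1 mulmxA mulmxKpV ?subrr.
Qed.

Lemma mul_col_projector_slice X i :
  right_unfold X *m pinvmx (right_unfold X) *m slice X i = slice X i.
Proof.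
apply/eqP; rewrite -subr_eq0 -{2}[slice X i]mul1mx -mulmxBl; apply/eqP.
move: i; apply/mul_right_unfold_eq0.
by rewrite mulmxBl mul1mx mulmxKpV ?subrr.
Qed.

Lemma mode1_prod_nondegenerate p q X (A : 'M_(p, q)) : lsize X = q ->
  row_full A -> row_free A -> nondegenerate X -> nondegenerate (mode1_prod X A).
Proof.
case: X => l r s /= El; case: _ / El A => A A_full A_free.
move=> /nondegenerate_eq0 [/= Xl Xr]; apply: nondegenerateP => m v /= v0.
  apply: Xl => i; apply: (row_full_inj A_full).
  by have:= v0 i; rewrite conform_mx_id mulmxA mulmx0.
apply: (row_free_inj A_free); rewrite mul0mx; apply: Xr => i.
by have:= v0 i; rewrite conform_mx_id mulmxA.
Qed.

Lemma mode3_prod_nondegenerate p q X (A : 'M_(q, p)) : rsize X = q ->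
  row_full A -> row_free A ->
  nondegenerate X -> nondegenerate (mode3_prod X A^T).
Proof.
case: X => l r s /= El; case: _ / El A => A A_full A_free.
move=> /nondegenerate_eq0 [/= Xl Xr]; apply: nondegenerateP => m v /= v0.
  apply: (row_full_inj A_full); rewrite mulmx0; apply: Xl => i.
  by have:= v0 i; rewrite conform_mx_id trmxK mulmxA.
apply: Xr => i; apply: (row_free_inj A_free).
by have:= v0 i; rewrite conform_mx_id trmxK mulmxA mul0mx.
Qed.

Lemma slice_left_fold X m (Q : 'M_(lsize X * n, m)) (S : 'M_(m, rsize X)) i :
  left_unfold X = Q *m S -> slice X i = slice (left_fold Q) i *m S.
Proof.
move=> XE; apply/matrixP => a c.
have := congr1 (fun M : 'M_(_, _) => M (colmajor a i) c) XE.
rewrite !mxE colmajorK_fst colmajorK_snd => ->.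
by apply: eq_bigr => j _; rewrite !mxE.
Qed.

Lemma slice_right_fold X m (A : 'M_(lsize X, m)) (B : 'M_(m, n * rsize X)) i :
  right_unfold X = A *m B -> slice X i = A *m slice (right_fold B) i.
Proof.
move=> XE; apply/matrixP => a c.
have := congr1 (fun M : 'M_(_, _) => M a (colmajor i c)) XE.
rewrite !mxE colmajorK_fst colmajorK_snd => ->.
by apply: eq_bigr => j _; rewrite !mxE.
Qed.

Lemma left_foldK l m (Q : 'M[F]_(l * n, m)) : left_unfold (left_fold Q) = Q.
Proof. by apply/matrixP => p c; rewrite !mxE colmajorK. Qed.

Lemma right_foldK m r (B : 'M[F]_(m, n * r)) : right_unfold (right_fold B) = B.
Proof. by apply/matrixP => p c; rewrite !mxE colmajorK. Qed.

(** The slices of X are those of the folded factor Q times S, so that a row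
  vector that kills the latter kills the former: replacing X by Q preserves
  the rank of the right unfolding as well. *)
Lemma left_factor_nondegenerate X m (Q : 'M_(lsize X * n, m))
    (S : 'M_(m, rsize X)) :
  left_unfold X = Q *m S -> (m <= rsize X)%N -> nondegenerate X ->
  [/\ m = rsize X, row_full S, row_free S & nondegenerate (left_fold Q)].
Proof.
move=> XE le_m X_nd; have /andP[XQ _] := X_nd; rewrite XE in XQ.
have [Em Q_full S_full S_free] := row_full_factor XQ le_m; split=> //.
have [Xl Xr] := nondegenerate_eq0 X_nd.
apply/andP; split; first by rewrite left_foldK.
apply/row_free_right_unfoldP => t u uX0; apply: Xr => i.
by rewrite (slice_left_fold i XE) mulmxA uX0 mul0mx.
Qed.

Lemma right_factor_nondegenerate X m (A : 'M_(lsize X, m))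
    (B : 'M_(m, n * rsize X)) :
  right_unfold X = A *m B -> (m <= lsize X)%N -> nondegenerate X ->
  [/\ m = lsize X, row_full A, row_free A & nondegenerate (right_fold B)].
Proof.
move=> XE le_m X_nd; have /andP[_ XA] := X_nd; rewrite XE in XA.
have [Em A_full A_free B_free] := row_free_factor XA le_m; split=> //.
have [Xl Xr] := nondegenerate_eq0 X_nd.
apply/andP; split; last by rewrite right_foldK.
apply/row_full_left_unfoldP => t v Xv0; apply: Xl => i.
by rewrite (slice_right_fold i XE) -mulmxA Xv0 mulmx0.
Qed.

End Unfoldings.

(** * Minimal representations have nondegenerate cores *)

(** Compressing every bond to the image of its projector would otherwise lower
  the rank vector. *)
Lemma minimal_idempotent_full (F : fieldType) (d : nat) (n : 'I_d -> nat)
    (T : tensor F n) (r : nat -> nat) (G : tr_cores F n r)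
    (E : forall m, 'M[F]_(r m)) (rd : r d = r 0) :
  (0 < d)%N -> minimal_rank T r -> tr_representation T G ->
  (exists i, T i != 0) ->
  (forall m, E m *m E m = E m) -> castmx (rd, rd) (E d) = E 0 ->
  (forall k i, G k i *m E k.+1 = G k i) \/
    (forall (k : 'I_d) i, E k *m G k i = G k i) ->
  forall m, (m <= d)%N -> row_full (E m).
Proof.
move=> d_gt0 [_ r_min] TG T_neq0 EE Ed EG m le_md.
have [sd [Cd Bd]] := base_castmx Ed.
apply/eqP; apply: (r_min (fun m => \rank (E m))) => // [|k _]; last first.
  exact: rank_leq_row.
apply: (tr_rank_compress (C := fun m => col_base (E m))
  (B := fun m => row_base (E m)) _ _ _ Cd Bd TG) => // [k|].
  exact: idempotent_base.
by case: EG => EG; [left | right] => k i; rewrite mulmx_base.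
Qed.

(** At the bond of the core k the projector is the one onto the row space of its
  left unfolding (resp. the column space of its right unfolding), at all other
  bonds it is the identity. *)
Lemma minimal_nondegenerate (F : fieldType) (d : nat) (n : 'I_d -> nat)
    (T : tensor F n) (r : nat -> nat) (G : tr_cores F n r) (k : 'I_d) :
  minimal_rank T r -> tr_representation T G -> (exists i, T i != 0) ->
  nondegenerate (Core (G k)).
Proof.
move=> r_min TG T_neq0; have [_ [rd _]] := TG.
have d_gt0 : (0 < d)%N by apply: leq_ltn_trans (ltn_ord k).
have d_neq0 : d != 0%N by rewrite -lt0n.
have E_full := minimal_idempotent_full d_gt0 r_min TG T_neq0.
set X := Core (G k); apply/andP; split.
  (* If k is the last core, its projector must also be placed at bond 0, which
     is the same bond as d. *)
  pose P : 'M_(r k.+1) := pinvmx (left_unfold X) *m left_unfold X.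
  pose D : forall m, 'M[F]_(r m) :=
    dfwith (fun m => 1%:M : 'M_(r m)) (i := k.+1) P.
  pose E : forall m, 'M[F]_(r m) := dfwith D (i := 0) (castmx (rd, rd) (D d)).
  have DD m : D m *m D m = D m.
    rewrite /D; case: dfwithP => [|j _]; last exact: mulmx1.
    by rewrite /P -mulmxA (mulmxA (left_unfold X)) mulmxKpV.
  have EE m : E m *m E m = E m.
    by rewrite /E; case: dfwithP => [|j _] //; rewrite -castmx_mulmx DD.
  have Ed : castmx (rd, rd) (E d) = E 0.
    by rewrite /E dfwith_in dfwith_out // eq_sym.
  have GE : forall j i, G j i *m E j.+1 = G j i.
    move=> j i; rewrite /E dfwith_out //; have [jk | j_neq_k] := eqVneq k j.
      case: _ / jk i => i.
      by rewrite /D dfwith_in (slice_mul_row_projector X i).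
    by rewrite /D dfwith_out ?mulmx1.
  have := E_full E rd EE Ed (or_introl GE) k.+1 (ltn_ord k).
  rewrite /E dfwith_out // /D dfwith_in -!sub1mx => /submx_trans-> //.
  exact: submxMl.
(* Symmetrically, bond d must repeat bond 0 in case k is the first core. *)
pose P : 'M_(r k) := right_unfold X *m pinvmx (right_unfold X).
pose D : forall m, 'M[F]_(r m) :=
  dfwith (fun m => 1%:M : 'M_(r m)) (i := val k) P.
pose E : forall m, 'M[F]_(r m) :=
  dfwith D (i := d) (castmx (esym rd, esym rd) (D 0)).
have DD m : D m *m D m = D m.
  rewrite /D; case: dfwithP => [|j _]; last exact: mulmx1.
  by rewrite /P mulmxA mulmxKpV.
have EE m : E m *m E m = E m.
  by rewrite /E; case: dfwithP => [|j _] //; rewrite -castmx_mulmx DD.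
have Ed : castmx (rd, rd) (E d) = E 0.
  by rewrite /E dfwith_in dfwith_out // castmxKV.
have EG : forall (j : 'I_d) i, E j *m G j i = G j i.
  move=> j i; rewrite /E dfwith_out ?gtn_eqF //.
  have [jk | j_neq_k] := eqVneq k j.
    case: _ / jk i => i.
    by rewrite /D dfwith_in (mul_col_projector_slice X i).
  by rewrite /D dfwith_out ?mul1mx.
have := E_full E rd EE Ed (or_intror EG) k (ltnW (ltn_ord k)).
rewrite /E dfwith_out ?gtn_eqF // /D dfwith_in /row_full => /eqP P_full.
by rewrite /row_free eqn_leq rank_leq_row -[leqLHS]P_full mxrankM_maxl.
Qed.

(** * Block-diagonal cores *)

Lemma block_cores_nondegenerate (F : fieldType) (d : nat) (n : 'I_d -> nat)
    (r' r'' : nat -> nat) (G' : tr_cores F n r') (G'' : tr_cores F n r'')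
    (k : 'I_d) :
  nondegenerate (Core (G' k)) -> nondegenerate (Core (G'' k)) ->
  nondegenerate (state_of_cores (block_cores G' G'') k).
Proof.
move=> /nondegenerate_eq0 [/= ker_l' ker_r'].
move=> /nondegenerate_eq0 [/= ker_l'' ker_r''].
apply: nondegenerateP => m v /= v0.
  have vE i : G' k i *m usubmx v = 0 /\ G'' k i *m dsubmx v = 0.
    have := v0 i; rewrite -{1}[v]vsubmxK mul_block_col !mul0mx addr0 add0r.
    by rewrite -col_mx0 => /eq_col_mx.
  rewrite -[v]vsubmxK (ker_l' _ (usubmx v)) => [|i]; last by case: (vE i).
  by rewrite (ker_l'' _ (dsubmx v)) ?col_mx0 // => i; case: (vE i).
have vE i : lsubmx v *m G' k i = 0 /\ rsubmx v *m G'' k i = 0.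
  have := v0 i; rewrite -{1}[v]hsubmxK mul_row_block !mulmx0 addr0 add0r.
  by rewrite -row_mx0 => /eq_row_mx.
rewrite -[v]hsubmxK (ker_r' _ (lsubmx v)) => [|i]; last by case: (vE i).
by rewrite (ker_r'' _ (rsubmx v)) ?row_mx0 // => i; case: (vE i).
Qed.

(** * Exact singular value decompositions *)

Lemma frob_norm_le0 (R : rcfType) (p q : nat) (A : 'M[R]_(p, q)) :
  frob_norm A <= 0 -> A = 0.
Proof.
move=> A_le0; apply/matrixP => i j; rewrite mxE.
have sq_ge0 a : 0 <= \sum_b A a b ^+ 2.
  by apply: sumr_ge0 => b _; apply: sqr_ge0.
have : \sum_a \sum_b A a b ^+ 2 == 0.
  rewrite eq_le sumr_ge0 // andbT -sqrtr_eq0.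
  by rewrite eq_le sqrtr_ge0 A_le0.
rewrite psumr_eq0 // => /allP/(_ i (mem_index_enum i)) /=.
rewrite psumr_eq0 => [|b _]; last exact: sqr_ge0.
by move=> /allP/(_ j (mem_index_enum j)) /=; rewrite sqrf_eq0 => /eqP.
Qed.

Lemma truncated_svd0 (R : rcfType) (p q t : nat) (A : 'M[R]_(p, q))
    (U : 'M_(p, t)) (Sigma : 'M_t) (V : 'M_(q, t)) :
  is_truncated_svd 0 A U Sigma V -> A = U *m Sigma *m V^T /\ (t <= p)%N.
Proof.
move=> [s [U0 [sigma [V0 [[UU _ _ _ _] [le_ts [_ _ _ AE _]]]]]]]; split.
  by apply/eqP; rewrite -subr_eq0; apply/eqP/frob_norm_le0.
apply: leq_trans le_ts _; rewrite -(mxrank1 R s) -UU.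
by apply: leq_trans (mxrankM_maxr _ _) (rank_leq_row _).
Qed.

(** * Invariance under the steps of TR-rounding *)

Section Rounding.
Variables (R : rcfType) (d : nat) (n : 'I_d -> nat) (r : nat -> nat).
Implicit Types (G H : state R n) (k : 'I_d).

Definition nondegenerate_state G : Prop :=
  forall k, [/\ lsize (G k) = r k, rsize (G k) = r k.+1 & nondegenerate (G k)].

Lemma dfwith_nondegenerate G k (X : core R (n k)) :
  nondegenerate_state G ->
  lsize X = r k -> rsize X = r k.+1 -> nondegenerate X ->
  nondegenerate_state (dfwith G X).
Proof.
by move=> G_nd lX rX X_nd j; case: dfwithP => [|m _]; [split | apply: G_nd].
Qed.

Lemma qr_step_nondegenerate k G H : (k.+1 < d)%N ->
  qr_step k G H -> nondegenerate_state G -> nondegenerate_state H.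
Proof.
move=> lt_kd [Q [S [[_ _ GE] ->]]] G_nd.
have [lk rk k_nd] := G_nd k; have [lk1 rk1 k1_nd] := G_nd (ordS k).
have k1E : ordS k = k.+1 :> nat by rewrite /= modn_small.
have [Em S_full S_free Q_nd] :=
  left_factor_nondegenerate GE (geq_minr _ _) k_nd.
apply: dfwith_nondegenerate => //=; last first.
- by apply: mode1_prod_nondegenerate => //; rewrite lk1 rk k1E.
- exact: etrans Em (etrans rk (esym (congr1 r k1E))).
by apply: dfwith_nondegenerate => //=; rewrite Em.
Qed.

(** The triangular factor has full rank, hence so has the diagonal factor of
  an exact SVD of it, and the branch that would modify the cores is not
  taken. *)
Lemma cyclic_step_nondegenerate k G H :
  cyclic_step 0 k G H -> nondegenerate_state G -> H = G.
Proof.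
move=> [Q [S [[_ _ GE] [t [U [Sigma [V [/truncated_svd0 [SE _] ->]]]]]]]] G_nd.
have [_ _ k_nd] := G_nd k.
have [_ /eqP S_full _ _] := left_factor_nondegenerate GE (geq_minr _ _) k_nd.
suff -> : (\rank Sigma < rsize (G k))%N = false by [].
apply/negbTE; rewrite -leqNgt -[X in (X <= _)%N]S_full SE.
exact: leq_trans (mxrankM_maxl _ _) (mxrankM_maxr _ _).
Qed.

Lemma svd_step_nondegenerate k G H : (0 < k)%N ->
  svd_step 0 k G H -> nondegenerate_state G -> nondegenerate_state H.
Proof.
move=> k_gt0 [t [U [Sigma [V [/truncated_svd0 [GE le_t] ->]]]]] G_nd.
have [lk rk k_nd] := G_nd k; have [lk1 rk1 k1_nd] := G_nd (ord_pred k).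
have k1E : (ord_pred k).+1 = k :> nat.
  rewrite /= -{1}(prednK k_gt0) addSn /= modnDr modn_small ?prednK //.
  exact: ltnW.
have [Em A_full A_free V_nd] := right_factor_nondegenerate GE le_t k_nd.
apply: dfwith_nondegenerate => //=; last first.
- by apply: mode3_prod_nondegenerate => //; rewrite lk rk1 k1E.
- exact: etrans Em (etrans lk (esym (congr1 r k1E))).
by apply: dfwith_nondegenerate => //=; rewrite Em.
Qed.

Lemma sweep_invariant (I : state R n -> Prop) step (ks : seq 'I_d) G H :
  (forall k G1 G2, k \in ks -> step k G1 G2 -> I G1 -> I G2) ->
  sweep step ks G H -> I G -> I H.
Proof.
elim: ks G => [|k ks IH] G stepI /=; first by move=> ->.
move=> [G1 GG1 G1H] IG; apply: IH G1H _ => [j G2 G3 j_ks|].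
  by apply: stepI; rewrite inE j_ks orbT.
by apply: stepI GG1 IG; rewrite inE eqxx.
Qed.

End Rounding.

(** * Exact rounding of a sum of minimal representations *)

Theorem proposition3p6 (R : realType) (d : nat) (hd : (2 <= d)%N)
    (n : 'I_d -> nat) (T' T'' T : tensor R n) (r' r'' : nat -> nat)
    (G' : tr_cores R n r') (G'' : tr_cores R n r'')
    (hT' : tr_representation T' G') (hT'' : tr_representation T'' G'')
    (hT : tr_representation T (block_cores G' G''))
    (T'_neq0 : exists i, T' i != 0) (T''_neq0 : exists i, T'' i != 0)
    (min' : minimal_rank T' r') (min'' : minimal_rank T'' r'')
    (H : state R n) :
  tr_rounding T (block_cores G' G'') 0 H ->
  forall k : 'I_d,
    lsize (H k) = (r' k + r'' k)%N /\ rsize (H k) = (r' k.+1 + r'' k.+1)%N.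
Proof.
rewrite /tr_rounding !mul0r => -[G1 [G2 [last [qr_sweep _ cyclic svd_sweep]]]].
pose r k := (r' k + r'' k)%N.
have G_nd : nondegenerate_state r (state_of_cores (block_cores G' G'')).
  move=> k; split=> //; apply: block_cores_nondegenerate.
    exact: minimal_nondegenerate min' hT' T'_neq0.
  exact: minimal_nondegenerate min'' hT'' T''_neq0.
have G1_nd : nondegenerate_state r G1.
  apply: sweep_invariant qr_sweep G_nd => k X Y.
  rewrite mem_filter => /andP[lt_kd _].
  exact: qr_step_nondegenerate.
rewrite (cyclic_step_nondegenerate cyclic G1_nd) in svd_sweep.
suff H_nd : nondegenerate_state r H by move=> k; case: (H_nd k).
apply: sweep_invariant svd_sweep G1_nd => k X Y.
rewrite mem_rev mem_filter => /andP[k_gt0 _].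
exact: svd_step_nondegenerate.
Qed.
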